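(* For a finite simple graph $G$ the following statements are equivalent: (1) $G$ admits a $\{{}^bP_3,{}^rP_3,{}^bK_3,{}^rK_3,{}^{rbb}K_3\}$-free $2$-edge-colouring. (2) $G$ admits a $\{{}^bP_3,{}^rP_3,{}^bK_3,{}^rK_3,{}^{rrb}K_3\}$-free $2$-edge-colouring. (3) Each connected component of $G$ is an induced subgraph of either $K_4$, the diamond, an even cycle, or an odd-butterfly. (4) $G$ is a $\{K_5, \text{odd-hole}, \text{claw}, \text{house}, \text{bull}, K_4+l, \text{kite}, X_1, X_2, K_5-e, \text{gem}, 4\text{-wheel}, \text{even-butterfly}\}$-free graph.
   Context: Graphs are finite and simple. A $2$-edge-colouring of $G$ assigns to every edge the colour red or blue (not necessarily properly). For a set $\mathcal F$ of $2$-edge-coloured graphs, a $2$-edge-colouring of $G$ is $\mathcal F$-free if no induced $2$-edge-coloured subgraph is isomorphic (preserving colours) to a member of $\mathcal F$. Patterns on three vertices: ${}^rP_3$ (resp. ${}^bP_3$) is the path on three vertices with both edges red (resp. blue); ${}^rK_3$ (resp. ${}^bK_3$) is the triangle with all edges red (resp. blue); ${}^{rrb}K_3$ is the triangle with two red and one blue edge; ${}^{rbb}K_3$ is the triangle with one red and two blue edges. For uncoloured graphs, being free of a set of graphs means containing no induced subgraph isomorphic to a member. Claw: $K_{1,3}$. Diamond: $K_4$ minus an edge. House: $C_4$ plus a new vertex adjacent to exactly two adjacent vertices of the $C_4$. Bull: a triangle plus two new non-adjacent vertices, each adjacent to exactly one vertex of the triangle, these two triangle vertices being distinct. $4$-wheel: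 join of $C_4$ and $K_1$. Gem: join of $P_4$ and $K_1$. Kite: diamond plus a new vertex adjacent to exactly one vertex of the diamond, which has degree $2$ in the diamond. $X_1$: diamond plus a new vertex adjacent to exactly the two vertices of degree $2$ of the diamond. $X_2$: diamond plus a new vertex adjacent to both vertices of degree $3$ and to exactly one vertex of degree $2$ of the diamond. $K_4+l$: $K_4$ plus a new vertex adjacent to exactly one vertex of the $K_4$. $K_5-e$: $K_5$ minus one edge. An odd-hole is a chordless cycle of odd length at least $5$; an even cycle is a cycle $C_{2m}$ with $m\ge 2$. For $n\ge 0$, the $n$-butterfly consists of two triangles joined by a path of length $n$ (one vertex of each triangle is an end of the path; for $n=0$ the two triangles share exactly one vertex). An even-butterfly (resp. odd-butterfly) is a $2n$-butterfly (resp. $(2n+1)$-butterfly) for some $n\ge 0$. *)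

(* Defs.v *)
From Stdlib Require List.
From mathcomp Require Import all_boot.

Set Implicit Arguments.
Unset Strict Implicit.
Unset Printing Implicit Defensive.

Record sgraph := SGraph {
  svertex :> finType;
  sedge : rel svertex;
  sedge_sym : symmetric sedge;
  sedge_irrefl : irreflexive sedge }.

Arguments sedge {s} x y.
Notation "x -- y" := (sedge x y) (at level 30).

Section Induced.
Variables (G : sgraph) (S : {set G}).

Definition ind_rel : rel {x : G | x \in S} := fun x y => val x -- val y.

Lemma ind_rel_sym : symmetric ind_rel.
Proof. by move=> x y; apply: sedge_sym. Qed.

Lemma ind_rel_irrefl : irreflexive ind_rel.
Proof. by move=> x; apply: sedge_irrefl. Qed.

Definition induced : sgraph := SGraph ind_rel_sym ind_rel_irrefl.
End Induced.

Definition isomorphic (G H : sgraph) : Prop :=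
  exists2 f : G -> H, bijective f & forall x y : G, (f x -- f y) = (x -- y).

Definition induced_subgraph_of (H G : sgraph) : Prop :=
  exists S : {set G}, isomorphic (induced S) H.

Definition induced_free (F : sgraph -> Prop) (G : sgraph) : Prop :=
  forall H : sgraph, F H -> ~ induced_subgraph_of H G.

Definition components (G : sgraph) : {set {set G}} :=
  equivalence_partition (connect (@sedge G)) [set: G].

Variant colour := Red | Blue.

(* A colouring is a symmetric function on pairs of vertices; its values on     *)
(* pairs that are not edges are never looked at (see [cisomorphic]).           *)
Record colouring (G : sgraph) := Colouring {
  col :> G -> G -> colour;
  col_sym : forall x y, col x y = col y x }.

Record cgraph := CGraph {
  cg_graph :> sgraph;
  cg_col : colouring cg_graph }.

Section CInduced.
Variables (G : cgraph) (S : {set G}).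

Definition ind_col (x y : induced S) : colour := cg_col G (val x) (val y).

Lemma ind_col_sym x y : ind_col x y = ind_col y x.
Proof. exact: col_sym. Qed.

Definition cinduced : cgraph := CGraph (Colouring ind_col_sym).
End CInduced.

Definition cisomorphic (G H : cgraph) : Prop :=
  exists f : G -> H, [/\ bijective f,
    forall x y : G, (f x -- f y) = (x -- y) &
    forall x y : G, x -- y -> cg_col H (f x) (f y) = cg_col G x y].

Definition cinduced_subgraph_of (H G : cgraph) : Prop :=
  exists S : {set G}, cisomorphic (cinduced S) H.

Definition cinduced_free (F : cgraph -> Prop) (G : cgraph) : Prop :=
  forall H : cgraph, F H -> ~ cinduced_subgraph_of H G.

Definition admits_free_colouring (F : cgraph -> Prop) (G : sgraph) : Prop :=
  exists c : colouring G, cinduced_free F (CGraph c).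

(* The graph on {0, ..., n-1} whose edges are the pairs of distinct vertices   *)
(* related, in one direction or the other, by [r].                             *)
Section GraphOn.
Variables (n : nat) (r : rel nat).

Definition on_rel : rel 'I_n := fun x y => (x != y) && (r x y || r y x).

Lemma on_rel_sym : symmetric on_rel.
Proof. by move=> x y; rewrite /on_rel eq_sym orbC. Qed.

Lemma on_rel_irrefl : irreflexive on_rel.
Proof. by move=> x; rewrite /on_rel eqxx. Qed.

Definition graph_on : sgraph := SGraph on_rel_sym on_rel_irrefl.
End GraphOn.

Definition graph_of (n : nat) (E : seq (nat * nat)) : sgraph :=
  graph_on n (fun i j => (i, j) \in E).

Definition complete_graph (n : nat) : sgraph := graph_on n (fun _ _ => true).

Definition path_graph (n : nat) : sgraph := graph_on n (fun i j => j == i.+1).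

Definition cycle_graph (n : nat) : sgraph :=
  graph_on n (fun i j => j == i.+1 %% n).

(* The path of length n is 2, ..., n+2; the triangles are {0, 1, 2} and        *)
(* {n+2, n+3, n+4}.                                                            *)
Definition butterfly (n : nat) : sgraph :=
  graph_on (n + 5) (fun i j => [|| j == i.+1, (i == 0) && (j == 2)
                                 | (i == n + 2) && (j == n + 4)]).

Definition C4_edges : seq (nat * nat) := [:: (0, 1); (1, 2); (2, 3); (3, 0)].

Definition K4_edges : seq (nat * nat) :=
  [:: (0, 1); (0, 2); (0, 3); (1, 2); (1, 3); (2, 3)].

(* K4 minus the edge {0, 3}: 0 and 3 have degree 2, 1 and 2 have degree 3.     *)
Definition diamond_edges : seq (nat * nat) := rem (0, 3) K4_edges.

Definition claw : sgraph := graph_of 4 [:: (0, 1); (0, 2); (0, 3)].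

Definition diamond : sgraph := graph_of 4 diamond_edges.

Definition house : sgraph := graph_of 5 (C4_edges ++ [:: (4, 0); (4, 1)]).

Definition bull : sgraph :=
  graph_of 5 [:: (0, 1); (0, 2); (1, 2); (3, 0); (4, 1)].

Definition wheel4 : sgraph :=
  graph_of 5 (C4_edges ++ [:: (4, 0); (4, 1); (4, 2); (4, 3)]).

Definition gem : sgraph :=
  graph_of 5 [:: (0, 1); (1, 2); (2, 3); (4, 0); (4, 1); (4, 2); (4, 3)].

Definition kite : sgraph := graph_of 5 (diamond_edges ++ [:: (4, 0)]).

Definition X1 : sgraph := graph_of 5 (diamond_edges ++ [:: (4, 0); (4, 3)]).

Definition X2 : sgraph :=
  graph_of 5 (diamond_edges ++ [:: (4, 1); (4, 2); (4, 0)]).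

Definition K4l : sgraph := graph_of 5 (K4_edges ++ [:: (4, 0)]).

(* K5 minus the edge {0, 4}. *)
Definition K5e : sgraph :=
  graph_of 5 (K4_edges ++ [:: (4, 1); (4, 2); (4, 3)]).

Variant forbidden : sgraph -> Prop :=
| Forb_K5 : forbidden (complete_graph 5)
| Forb_odd_hole (m : nat) : 2 <= m -> forbidden (cycle_graph m.*2.+1)
| Forb_claw : forbidden claw
| Forb_house : forbidden house
| Forb_bull : forbidden bull
| Forb_K4l : forbidden K4l
| Forb_kite : forbidden kite
| Forb_X1 : forbidden X1
| Forb_X2 : forbidden X2
| Forb_K5e : forbidden K5e
| Forb_gem : forbidden gem
| Forb_wheel4 : forbidden wheel4
| Forb_even_butterfly (n : nat) : forbidden (butterfly n.*2).

Definition monochrome (G : sgraph) (a : colour) : cgraph :=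
  CGraph (@Colouring G (fun _ _ => a) (fun _ _ => erefl)).

Section OneEdge.
Variables a b : colour.

Definition K3_col (x y : complete_graph 3) : colour :=
  if x + y == 1 then b else a.

Lemma K3_col_sym x y : K3_col x y = K3_col y x.
Proof. by rewrite /K3_col addnC. Qed.

(* The triangle whose edge {0, 1} has colour b and whose other two edges have  *)
(* colour a.                                                                   *)
Definition mixed_K3 : cgraph := CGraph (Colouring K3_col_sym).
End OneEdge.

Definition rP3 : cgraph := monochrome (path_graph 3) Red.
Definition bP3 : cgraph := monochrome (path_graph 3) Blue.
Definition rK3 : cgraph := monochrome (complete_graph 3) Red.
Definition bK3 : cgraph := monochrome (complete_graph 3) Blue.
Definition rrbK3 : cgraph := mixed_K3 Red Blue.
Definition rbbK3 : cgraph := mixed_K3 Blue Red.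

(* [List.In] rather than [\in]: cgraph has no decidable equality.              *)
Definition pattern_set (s : seq cgraph) (H : cgraph) : Prop := List.In H s.

(* Main.v *)
(* Forbidding the five patterns of (1) says that every connected triple of      *)
(* vertices spans exactly one blue edge, and (2) says the same of red, so (1)   *)
(* and (2) are exchanged by swapping the colours. Such a blue set exists on     *)
(* each graph of (3), where vertices are numbered 0, 1, 2, ... : take the       *)
(* edges {2i, 2i+1}. It passes to induced subgraphs and glues over components.  *)
(* No graph of (4) carries one: blue and red alternate along induced paths,     *)
(* which is a parity clash on odd holes and even butterflies, and the other     *)
(* graphs are small. Conversely, in a graph as in (4), a K4 or an induced       *)
(* diamond has no further neighbours, hence is a whole component. Any other     *)
(* component has no K4 or diamond, and then in a triangle at most one vertex    *)
(* has further neighbours (no bull or house). It follows that a longest path    *)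
(* p_0 ... p_k of the component is Hamiltonian and that its only possible       *)
(* chords are p_0 p_2, p_(k-2) p_k and p_0 p_k, which leaves cycles and         *)
(* induced subgraphs of butterflies.                                            *)
Require Import Defs.
From mathcomp Require Import all_boot.
From mathcomp Require Import zify.

Set Implicit Arguments.
Unset Strict Implicit.
Unset Printing Implicit Defensive.

(** Call [G] matchable if some set of edges contains exactly one edge of every connected triple of
    vertices ([one_blue]). By [free_colouringP] each of the two colouring statements says just that,
    the set being the blue edges in one case and the red ones in the other. Being matchable passes
    to induced subgraphs ([matchable_embedding]) and can be checked on components
    ([matchable_components]). Hence (3) implies matchability, through explicit pairings, and
    matchability implies (4) by [forbidden_unmatchable].

    The converse, from (4) to (3), is [free_component]. By [K4_closed] and [diamond_closed], a K4 or
    a diamond fills its component. Elsewhere no two triangles share an edge, and [triangle_nbr] lets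
    at most one vertex of a triangle have neighbours outside it. An interior vertex of a longest
    path with a third neighbour lies in a triangle, since there is no claw, and such triangles fit
    only at the ends of the path ([longest_nbr]). So the path exhausts the component and its chords
    are very few ([longest_adj]). Forbidding odd holes and even butterflies then settles the parity
    ([longest_cycle], [longest_structure]). *)

(** * Induced subgraphs as embeddings *)

Lemma subset_of_injective (H G : finType) (f : H -> G) : injective f ->
  exists S : {set G}, exists2 g : {x | x \in S} -> H,
    bijective g & forall u, f (g u) = val u.
Proof.
move=> f_inj; pose S := [set x in codom f]; exists S.
have im (u : {x | x \in S}) : val u \in codom f by have := valP u; rewrite inE.
have mem h : f h \in S by rewrite inE codom_f.
exists (fun u => iinv (im u)) => [|u]; last exact: f_iinv.
exists (fun h => Sub (f h) (mem h)) => [u|h].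
  by apply: val_inj; rewrite /= f_iinv.
by apply: f_inj; rewrite f_iinv.
Qed.

Lemma injective_of_subset (H G : finType) (S : {set G}) (g : {x | x \in S} -> H) :
  bijective g -> exists2 f : H -> G, injective f & forall u, f (g u) = val u.
Proof.
case=> g' gK g'K; exists (val \o g') => [|u]; last by rewrite /= gK.
exact: inj_comp val_inj (can_inj g'K).
Qed.

Definition embedding (H G : sgraph) (f : H -> G) : Prop :=
  injective f /\ forall x y, (f x -- f y) = (x -- y).

Lemma induced_subgraphP (H G : sgraph) :
  induced_subgraph_of H G <-> exists f : H -> G, embedding f.
Proof.
split=> [[S [g g_bij gE]]|[f [f_inj fE]]].
  have [f f_inj fg] := injective_of_subset g_bij; exists f; split=> // x y.
  by case: g_bij fg gE => g' _ g'K fg gE; rewrite -(g'K x) -(g'K y) !fg gE.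
have [S [g g_bij fg]] := subset_of_injective f_inj; exists S; exists g => // x y.
by rewrite -fE !fg.
Qed.

Lemma cinduced_subgraphP (H G : cgraph) :
  cinduced_subgraph_of H G <->
  exists2 f : H -> G, embedding f &
    forall x y, x -- y -> cg_col G (f x) (f y) = cg_col H x y.
Proof.
split=> [[S [g [g_bij gE gc]]]|[f [f_inj fE] fc]].
  have [f f_inj fg] := injective_of_subset g_bij.
  case: g_bij fg gE gc => g' _ g'K fg gE gc; exists f.
    by split=> // x y; rewrite -(g'K x) -(g'K y) !fg gE.
  by move=> x y; rewrite -(g'K x) -(g'K y) !fg gE => /gc ->.
have [S [g g_bij fg]] := subset_of_injective f_inj; exists S; exists g.
have gE (x y : induced S) : (g x -- g y) = (x -- y) by rewrite -fE !fg.
by split=> // x y xy; rewrite -fc ?gE // !fg.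
Qed.

(** * Matchable graphs and free colourings *)

(* [m] is the set of blue edges (red ones for statement (2)); its values on     *)
(* pairs of non-adjacent vertices are irrelevant.                               *)
Definition one_blue (G : sgraph) (m : rel G) : Prop :=
  forall x y z : G, x -- y -> y -- z -> x != z ->
    m x y + m y z + ((x -- z) && m x z) = 1.

Definition matchable (G : sgraph) : Prop :=
  exists2 m : rel G, symmetric m & one_blue m.

Lemma matchable_embedding (H G : sgraph) (f : H -> G) :
  embedding f -> matchable G -> matchable H.
Proof.
case=> f_inj fE [m m_sym mP]; exists (fun x y => m (f x) (f y)) => [x y|x y z].
  exact: m_sym.
by rewrite -(inj_eq f_inj) -!fE; apply: mP.
Qed.

Lemma edge_neq (G : sgraph) (x y : G) : x -- y -> x != y.
Proof. by apply: contraTneq => ->; rewrite sedge_irrefl. Qed.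

Definition opp (a : colour) : colour := if a is Red then Blue else Red.

Definition is_col (a b : colour) : bool :=
  match a, b with Red, Red | Blue, Blue => true | _, _ => false end.

(** The patterns of (1) for [a = Blue] and those of (2) for [a = Red]: exactly the connected triples
    whose number of edges of colour [a] is not 1. *)
Definition patterns (a : colour) : seq cgraph :=
  [:: monochrome (path_graph 3) a; monochrome (path_graph 3) (opp a);
      monochrome (complete_graph 3) a; monochrome (complete_graph 3) (opp a);
      mixed_K3 a (opp a)].

(** The colour of [x z] is compared only if it is an edge, so that the lemma serves the paths as
    well as the triangles. *)
Lemma triple_cinduced (G : cgraph) (r : rel nat) (k : colouring (graph_on 3 r))
    (i0 i1 i2 : graph_on 3 r) (x y z : G) :
    val i0 = 0 -> val i1 = 1 -> val i2 = 2 -> uniq [:: x; y; z] ->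
    x -- y = i0 -- i1 -> y -- z = i1 -- i2 -> x -- z = i0 -- i2 ->
    cg_col G x y = k i0 i1 -> cg_col G y z = k i1 i2 ->
    (x -- z -> cg_col G x z = k i0 i2) ->
  cinduced_subgraph_of (CGraph k) G.
Proof.
move=> e0 e1 e2 s_uniq xy yz xz cxy cyz cxz.
have iP (i : graph_on 3 r) : [\/ i = i0, i = i1 | i = i2].
  by case: i => [[|[|[|i]]] lti] //; [apply: Or31 | apply: Or32 | apply: Or33];
    apply: val_inj.
pose f (i : graph_on 3 r) := nth x [:: x; y; z] (val i).
have [f0 f1 f2] : [/\ f i0 = x, f i1 = y & f i2 = z].
  by rewrite /f e0 e1 e2.
apply/cinduced_subgraphP; exists f.
  split=> [i j /eqP|i j].
    by rewrite nth_uniq //= => /eqP; apply: val_inj.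
  have [yx zy zx] : [/\ y -- x = i1 -- i0, z -- y = i2 -- i1 & z -- x = i2 -- i0].
    by split; rewrite sedge_sym ?xy ?yz ?xz sedge_sym.
  by case: (iP i) => ->; case: (iP j) => ->; rewrite ?f0 ?f1 ?f2 ?sedge_irrefl.
move=> i j /=.
have cE u v (l h : graph_on 3 r) : cg_col G u v = k l h -> cg_col G v u = k h l.
  by rewrite [cg_col G v u]col_sym [k h l]col_sym.
have nir u : on_rel r u u = false by apply: on_rel_irrefl.
case: (iP i) => ->; case: (iP j) => -> ij; rewrite ?f0 ?f1 ?f2;
  rewrite ?nir // in ij *; try by apply: cE.
  by apply: cxz; rewrite xz.
by apply/cE/cxz; rewrite xz sedge_sym.
Qed.

(** The set of edges of colour [a] and the colouring determine each other. The list [s] is compared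
    with [patterns a] by membership only, because (2) lists its patterns in another order. *)
Lemma free_colouringP (a : colour) (G : sgraph) (s : seq cgraph) :
    (forall H, pattern_set s H <-> List.In H (patterns a)) ->
  admits_free_colouring (pattern_set s) G <-> matchable G.
Proof.
pose i0 := @Ordinal 3 0 isT; pose i1 := @Ordinal 3 1 isT; pose i2 := @Ordinal 3 2 isT.
move=> sP; split=> [[c free]|[m m_sym mP]].
  exists (fun x y => is_col a (c x y)) => [x y|x y z xy yz neq_xz].
    by rewrite col_sym.
  have neq_xy := edge_neq xy; have neq_yz := edge_neq yz.
  have s_uniq : uniq [:: x; y; z] by rewrite /= !inE negb_or neq_xy neq_xz neq_yz.
  have abP b : b = a \/ b = opp a by case: (a) b => [] []; auto.
  have noP b : c x y = b -> c y z = b -> x -- z = false -> False.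
    move=> cxy cyz xz; apply: (free (monochrome (path_graph 3) b)).
      by apply/sP; case: (abP b) => ->; rewrite /=; tauto.
    by apply: (@triple_cinduced (CGraph c) _ _ i0 i1 i2 x y z); rewrite /= ?xz.
  have noK b : c x y = b -> c y z = b -> c x z = b -> x -- z -> False.
    move=> cxy cyz cxz xz; apply: (free (monochrome (complete_graph 3) b)).
      by apply/sP; case: (abP b) => ->; rewrite /=; tauto.
    exact: (@triple_cinduced (CGraph c) _ _ i0 i1 i2 x y z).
  have noM u v w : uniq [:: u; v; w] -> u -- v -> v -- w -> u -- w ->
      c u v = opp a -> c v w = a -> c u w = a -> False.
    move=> uvw_uniq uv vw uw cuv cvw cuw; apply: (free (mixed_K3 a (opp a))).
      by apply/sP; rewrite /=; tauto.
    exact: (@triple_cinduced (CGraph c) _ _ i0 i1 i2 u v w).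
  have yx : y -- x by rewrite sedge_sym.
  have zy : z -- y by rewrite sedge_sym.
  have [cyx czy] : c y x = c x y /\ c z y = c y z by split; apply: col_sym.
  have := noP a; have := noP (opp a).
  case xz: (x -- z); last first.
    by case: (a) (c x y) (c y z) => [] [] [] //= H1 H2; exfalso; eauto.
  move=> _ _.
  have zx : z -- x by rewrite sedge_sym.
  have czx : c z x = c x z by apply: col_sym.
  have := noK a; have := noK (opp a).
  have := noM x y z; have := noM x z y; have := noM y z x.
  rewrite /= !inE !negb_or !edge_neq // xy yz xz yx zy zx cyx czy czx.
  by case: (a) (c x y) (c y z) (c x z) => [] [] [] [] /= H1 H2 H3 H4 H5 //; exfalso; eauto.
have c_sym x y : (if m x y then a else opp a) = (if m y x then a else opp a).
  by rewrite m_sym.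
exists (Colouring c_sym) => H /sP H_in /cinduced_subgraphP[f [f_inj fE] fc].
have {fc} fc x y : x -- y -> m (f x) (f y) = is_col a (cg_col H x y).
  by move=> /fc <- /=; case: (m _ _); case: (a).
have {m_sym mP} mP x y z : x -- y -> y -- z -> x != z ->
    is_col a (cg_col H x y) + is_col a (cg_col H y z)
      + ((x -- z) && is_col a (cg_col H x z)) = 1.
  move=> xy yz neq_xz.
  have := mP (f x) (f y) (f z); rewrite !fE (inj_eq f_inj) => /(_ xy yz neq_xz) <-.
  rewrite (fc _ _ xy) (fc _ _ yz); case xz: (x -- z) => //.
  by rewrite fc.
move: H_in mP {fc fE f_inj f}; rewrite /=.
by case: (a) => -[<- | [<- | [<- | [<- | [<- | []]]]]] /(_ i0 i1 i2 isT isT isT).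
Qed.

(** * Gluing over connected components *)

Lemma connect_edge_sym (G : sgraph) : connect_sym (@sedge G).
Proof. exact/sym_connect_sym/sedge_sym. Qed.

Definition component (G : sgraph) (x : G) : {set G} :=
  [set y in [set: G] | connect (@sedge G) x y].

Lemma mem_component (G : sgraph) (x y : G) :
  (y \in component x) = connect (@sedge G) x y.
Proof. by rewrite !inE. Qed.

Lemma componentsP (G : sgraph) (C : {set G}) :
  reflect (exists x, C = component x) (C \in components G).
Proof.
apply: (iffP imsetP) => [[x _ ->]|[x ->]]; first by exists x.
by exists x; rewrite ?inE.
Qed.

Lemma matchable_components (G : sgraph) :
  (forall C : {set G}, C \in components G -> matchable (induced C)) -> matchable G.
Proof.
move=> Gm.
have /fin_all_exists[m mP] (x : G) : exists m : rel G, symmetric m /\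
    forall u v w, u \in component x -> u -- v -> v -- w -> u != w ->
      m u v + m v w + ((u -- w) && m u w) = 1.
  (* The relation on the component is extended to [G] by [false], which does no harm because a
     connected triple that meets the component lies inside it. *)
  have /Gm [m m_sym mP] : component x \in components G by apply/componentsP; exists x.
  pose M (u v : G) := if (insub u, insub v) is (Some u', Some v') then m u' v' else false.
  exists M; split=> [u v|u v w].
    by rewrite /M; case: insub => [u'|]; case: insub => [v'|] //=; apply: m_sym.
  rewrite mem_component => xu uv vw uw.
  have xv : connect (@sedge G) x v := connect_trans xu (connect1 uv).
  have xw : connect (@sedge G) x w := connect_trans xv (connect1 vw).
  rewrite -mem_component in xu; rewrite -mem_component in xv.
  rewrite -mem_component in xw.
  rewrite /M !insubT; exact: (mP (Sub u xu) (Sub v xv) (Sub w xw)).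
(* Vertices of one component may have been given different relations; evaluating at the root makes
   the choice constant on the component. *)
pose r := root (@sedge G).
exists (fun x y => connect (@sedge G) x y && m (r x) x y) => [x y|x y z xy yz xz].
  rewrite connect_edge_sym; case yx: (connect _ y x) => //=.
  rewrite (proj1 (mP (r x))); congr (m _ y x).
  by apply/(rootP (@connect_edge_sym G)); rewrite connect_edge_sym.
have rE u v : u -- v -> r v = r u.
  by move=> uv; apply/esym/(rootP (@connect_edge_sym G))/connect1.
rewrite (rE _ _ xy) (connect1 xy) (connect1 yz).
rewrite (connect_trans (connect1 xy) (connect1 yz)).
apply: (proj2 (mP (r x))) => //.
by rewrite mem_component connect_edge_sym connect_root.
Qed.

(** * The graphs of (3) are matchable *)

(** The blue edges are the pairs {2i, 2i+1}, that is, vertices with equal halves. The condition is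
    put on natural numbers so that computation or [lia] can settle it. *)
Lemma matchable_half (n : nat) (r : rel nat) :
    (forall i j k, i < n -> j < n -> k < n -> i != j -> j != k -> i != k ->
       r i j || r j i -> r j k || r k j ->
       (i./2 == j./2) + (j./2 == k./2) + ((r i k || r k i) && (i./2 == k./2)) = 1) ->
  matchable (graph_on n r).
Proof.
move=> rP; exists (fun x y : 'I_n => x./2 == y./2) => [x y|x y z]; first exact: eq_sym.
rewrite ![_ -- _]/= /on_rel => /andP[xy rxy] /andP[yz ryz] xz.
by rewrite xz; apply: rP.
Qed.

Lemma matchable_K4 : matchable (complete_graph 4).
Proof. by apply: matchable_half; do 3 case=> [|[|[|[|?]]]] //. Qed.

Lemma matchable_diamond : matchable diamond.
Proof. by apply: matchable_half; do 3 case=> [|[|[|[|?]]]] //. Qed.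

Lemma eq_half (i j : nat) : i != j ->
  (i./2 == j./2) = (j == i.+1) && ~~ odd i || (i == j.+1) && ~~ odd j.
Proof. lia. Qed.

(** The edges alternate, also across the closing edge because the length is even, and length at
    least 4 rules out triangles. *)
Lemma matchable_even_cycle m : 2 <= m -> matchable (cycle_graph m.*2).
Proof.
move=> m_ge2; apply: matchable_half => i j k lti ltj ltk ij jk ik.
have modE a b : a < m.*2 -> b == a.+1 %% m.*2 -> b = a.+1 \/ a.+1 = m.*2 /\ b = 0.
  rewrite leq_eqVlt => /orP[/eqP ->|lta]; first by rewrite modnn => /eqP; right.
  by rewrite modn_small // => /eqP; left.
have adjE a b : a < m.*2 -> b < m.*2 ->
    (b == a.+1 %% m.*2) || (a == b.+1 %% m.*2) ->
    b = a.+1 \/ a = b.+1 \/ a.+1 = m.*2 /\ b = 0 \/ b.+1 = m.*2 /\ a = 0.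
  by move=> lta ltb /orP[] /modE; tauto.
rewrite !eq_half // => /adjE-/(_ lti ltj) Eij /adjE-/(_ ltj ltk) Ejk.
have /negPf-> : ~~ ((k == i.+1 %% m.*2) || (i == k.+1 %% m.*2)).
  apply/negP => /adjE-/(_ lti ltk) Eik; clear -m_ge2 Eij Ejk Eik ij jk ik.
  lia.
clear modE adjE.
case: Eij => [?|[?|[[? ?]|[? ?]]]]; subst; (case: Ejk => [?|[?|[[? ?]|[? ?]]]]; subst).
all: lia.
Qed.

(** The last triangle starts at the odd number 2n+3, so in both triangles the blue edge is the one
    opposite to the path, and both end edges of the path are blue. *)
Lemma matchable_odd_butterfly n : matchable (butterfly n.*2.+1).
Proof.
apply: matchable_half => i j k lti ltj ltk ij jk ik; rewrite !eq_half //.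
have adjE a b : [|| b == a.+1, (a == 0) && (b == 2)
       | (a == n.*2.+1 + 2) && (b == n.*2.+1 + 4)] ->
    b = a.+1 \/ a = 0 /\ b = 2 \/ a = n.*2 + 3 /\ b = n.*2 + 5 by lia.
case/orP=> /adjE[?|[[? ?]|[? ?]]]; subst; case/orP=> /adjE[?|[[? ?]|[? ?]]]; subst.
all: try (exfalso; clear -ij jk ik; lia).
all: lia.
Qed.

(** * The graphs of (4) are not matchable *)

Fixpoint sublists (T : Type) (s : seq T) : seq (seq T) :=
  if s is x :: s' then map (cons x) (sublists s') ++ sublists s' else [:: [::]].

Lemma filter_sublists (T : eqType) (a : pred T) (s : seq T) :
  filter a s \in sublists s.
Proof.
elim: s => //= x s IHs; rewrite mem_cat; case: (a x); last by rewrite IHs orbT.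
by rewrite map_f.
Qed.

Definition adj (r : rel nat) : rel nat := fun i j => (i != j) && (r i j || r j i).

Definition edge_list (n : nat) (r : rel nat) : seq (nat * nat) :=
  [seq e <- [seq (i, j) | i <- iota 0 n, j <- iota 0 n] | (e.1 < e.2) && adj r e.1 e.2].

(** [edge_list] holds each edge once with its smaller end first, hence the lookup through [minn] and
    [maxn]. *)
Definition one_blueb (n : nat) (r : rel nat) (b : seq (nat * nat)) : bool :=
  let m i j := (minn i j, maxn i j) \in b in
  all (fun i => all (fun j => adj r i j ==>
    all (fun k => adj r j k && (i != k) ==>
      (m i j + m j k + (adj r i k && m i k) == 1)) (iota 0 n)) (iota 0 n)) (iota 0 n).

Definition unmatchableb (n : nat) (r : rel nat) : bool :=
  all (fun b => ~~ one_blueb n r b) (sublists (edge_list n r)).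

(** Moves the relation to natural numbers, where indices can be computed with; it is [false] out of
    range. *)
Lemma matchable_on (n : nat) (r : rel nat) : matchable (graph_on n r) ->
  exists2 m : rel nat, symmetric m & forall i j k, i < n -> j < n -> k < n ->
    adj r i j -> adj r j k -> i != k -> m i j + m j k + (adj r i k && m i k) = 1.
Proof.
case=> m m_sym mP; pose o (i : nat) : option 'I_n := insub i.
exists (fun i j => if (o i, o j) is (Some i', Some j') then m i' j' else false).
  by move=> i j; case: (o i) (o j) => [i'|] [j'|].
move=> i j k lti ltj ltk; rewrite /o !insubT.
exact: (mP (Ordinal lti) (Ordinal ltj) (Ordinal ltk)).
Qed.

(** Restricting a relation to the edges yields one of the lists in [sublists], so a finite search
    refutes all relations. It is run on the eleven forbidden graphs outside the two infinite
    families. *)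
Lemma unmatchableP (n : nat) (r : rel nat) :
  unmatchableb n r -> ~ matchable (graph_on n r).
Proof.
move=> /allP nm /matchable_on[m m_sym mP].
pose b := [seq e <- edge_list n r | m e.1 e.2].
have /negP[] := nm b (filter_sublists _ _).
have mE i j : i < n -> j < n -> adj r i j -> ((minn i j, maxn i j) \in b) = m i j.
  move=> lti ltj rij; rewrite mem_filter /edge_list /=; case: ltngtP => [ltij|ltji|eqij].
  - by rewrite mem_filter /= ltij rij /= allpairs_f ?mem_iota // andbT.
  - have rji : adj r j i by rewrite /adj eq_sym orbC.
    by rewrite mem_filter /= ltji rji /= allpairs_f ?mem_iota // andbT m_sym.
  - by rewrite /adj eqij eqxx in rij.
apply/allP=> i; rewrite mem_iota => lti.
apply/allP=> j; rewrite mem_iota => ltj; apply/implyP=> rij.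
apply/allP=> k; rewrite mem_iota => ltk; apply/implyP=> /andP[rjk neq_ik].
rewrite (mE i j) // (mE j k) // -(mP i j k) //; apply/eqP.
by case rik: (adj r i k) => //; rewrite mE.
Qed.

(** Colours alternate along the path 0, ..., 2m, so its first and last edges differ in colour; the
    closing edge would have to differ from both. *)
Lemma unmatchable_odd_hole (m : nat) : 2 <= m -> ~ matchable (cycle_graph m.*2.+1).
Proof.
move=> m_ge2 /matchable_on[c c_sym cP].
have modE i : i < m.*2.+1 -> i.+1 %% m.*2.+1 = if i == m.*2 then 0 else i.+1.
  by move=> lti; case: eqP => [->|ne]; rewrite ?modnn // modn_small; lia.
have alt i j k : i < m.*2.+1 -> j = i.+1 %% m.*2.+1 -> k = j.+1 %% m.*2.+1 ->
    c i j + c j k = 1.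
  move=> lti ji kj; have ltj : j < m.*2.+1 by rewrite ji ltn_mod.
  have ltk : k < m.*2.+1 by rewrite kj ltn_mod.
  have := cP i j k lti ltj ltk; have -> : adj (fun i j => j == i.+1 %% m.*2.+1) i k = false.
    move: ji kj; rewrite /adj !modE //.
    by case: (i =P m.*2) => ?; case: (j =P m.*2) => ?; case: (k =P m.*2) => ?; lia.
  rewrite addn0; apply; move: ji kj; rewrite /adj !modE //;
    by case: (i =P m.*2) => ?; case: (j =P m.*2) => ?; case: (k =P m.*2) => ?; lia.
have alt_odd i : i < m.*2 -> c i i.+1 = odd i (+) c 0 1.
  elim: i => // i IHi lti; have: c i i.+1 + c i.+1 i.+2 = 1.
    by apply: alt; rewrite ?modn_small; lia.
  rewrite IHi /=; last lia.
  by case: (odd i); case: (c 0 1); case: (c i.+1 i.+2).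
have e1 : c m.*2.-1 m.*2 + c m.*2 0 = 1.
  by apply: alt; rewrite ?modnn ?modn_small; lia.
have e2 : c m.*2 0 + c 0 1 = 1 by apply: alt; rewrite ?modnn ?modn_small; lia.
have := alt_odd m.*2.-1; rewrite prednK; last lia.
have -> : odd m.*2.-1 by lia.
rewrite leqnn => /(_ isT) e3; move: e1 e2; rewrite e3.
by case: (c 0 1); case: (c m.*2 0).
Qed.

(** At the vertex where a triangle continues, both triangle edges have the same colour, so both are
    red and the next edge is blue. Alternation along the induced path 1, ..., 2n+3 starts with the
    red edge {1, 2} and makes {2n+2, 2n+3} blue, whereas the second triangle requires it to be
    red. *)
Lemma unmatchable_even_butterfly (n : nat) : ~ matchable (butterfly n.*2).
Proof.
move=> /matchable_on[c c_sym]; set r := (fun i j : nat => _) => cP.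
have alt i j k : i < n.*2 + 5 -> j < n.*2 + 5 -> k < n.*2 + 5 ->
    adj r i j -> adj r j k -> i != k -> ~~ adj r i k -> c i j + c j k = 1.
  by move=> lti ltj ltk rij rjk ik /negPf rik; have := cP i j k; rewrite rik addn0; apply.
have tri i j k : i < n.*2 + 5 -> j < n.*2 + 5 -> k < n.*2 + 5 ->
    adj r i j -> adj r j k -> i != k -> adj r i k -> c i j + c j k + c i k = 1.
  by move=> lti ltj ltk rij rjk ik rik; have := cP i j k; rewrite rik; apply.
have alt_path i : 0 < i -> i < n.*2.+2 -> c i i.+1 + c i.+1 i.+2 = 1.
  by move=> i_gt0 lti; apply: alt; rewrite /adj /r; lia.
have alt_odd i : i < n.*2.+2 -> c i.+1 i.+2 = odd i (+) c 1 2.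
  elim: i => // i IHi lti; have := alt_path i.+1 isT; rewrite IHi /=; last lia.
  by move=> /(_ lti); case: (odd i); case: (c 1 2); case: (c i.+2 i.+3).
have t1 : c 0 1 + c 1 2 + c 0 2 = 1 by apply: tri; rewrite /adj /r; lia.
have t2 : c 0 2 + c 2 3 = 1 by apply: alt; rewrite /adj /r; lia.
have t3 : c n.*2.+2 n.*2.+3 + c n.*2.+3 n.*2.+4 + c n.*2.+2 n.*2.+4 = 1.
  by apply: tri; rewrite /adj /r; lia.
have t4 : c n.*2.+1 n.*2.+2 + c n.*2.+2 n.*2.+4 = 1.
  by apply: alt; rewrite /adj /r; lia.
have := alt_odd 1 isT; have := alt_odd n.*2.+1 (ltnSn _).
have := alt_odd n.*2 (ltnW (ltnSn _)); rewrite /= odd_double /= => e1 e2 e3.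
move: t1 t2 t3 t4; rewrite e1 e2 e3.
by case: (c 0 1) (c 1 2) (c 0 2) (c n.*2.+3 n.*2.+4) (c n.*2.+2 n.*2.+4) => [] [] [] [] [].
Qed.

Lemma forbidden_unmatchable (H : sgraph) : forbidden H -> ~ matchable H.
Proof.
case=> [|m|||||||||||n]; last exact: unmatchable_even_butterfly.
2: exact: unmatchable_odd_hole.
all: by apply: unmatchableP; vm_compute.
Qed.

Lemma matchable_free (G : sgraph) : matchable G -> induced_free forbidden G.
Proof.
move=> Gm H /forbidden_unmatchable Hm /induced_subgraphP[f fE].
exact/Hm/(matchable_embedding fE).
Qed.

(** * Induced subgraphs from vertex lists *)

Lemma list_induced (G : sgraph) (n : nat) (r : rel nat) (x0 : G) (s : seq G) :
    size s = n -> uniq s ->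
    (forall i j, i < j -> j < n -> nth x0 s i -- nth x0 s j = r i j || r j i) ->
  induced_subgraph_of (graph_on n r) G.
Proof.
move=> sz_s s_uniq sE; apply/induced_subgraphP.
exists (fun i : 'I_n => nth x0 s i); split=> [i j /eqP|i j].
  by rewrite nth_uniq ?sz_s // => /eqP/val_inj.
rewrite [RHS]/= /on_rel -val_eqE /=; case: (ltngtP i j) => [ltij|ltji|/val_inj->].
- by rewrite sE.
- by rewrite sedge_sym sE // orbC.
- by rewrite sedge_irrefl.
Qed.

(** The shift [d] places the list from vertex [d] on; with [d = 1] a path avoids the first triangle
    of a butterfly. *)
Lemma induced_list (G : sgraph) (n : nat) (r : rel nat) (x0 : G) (s : seq G)
    (C : {set G}) (d : nat) :
    uniq s -> {subset C <= s} -> d + size s <= n ->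
    (forall i j, i < j -> j < size s ->
       nth x0 s i -- nth x0 s j = r (d + i) (d + j) || r (d + j) (d + i)) ->
  induced_subgraph_of (induced C) (graph_on n r).
Proof.
move=> s_uniq Cs le_n sE; apply/induced_subgraphP.
have lt_n (u : induced C) : d + index (val u) s < n.
  by apply: leq_trans le_n; rewrite ltn_add2l index_mem Cs // (valP u).
have uE (u : induced C) : nth x0 s (index (val u) s) = val u.
  by rewrite nth_index // Cs // (valP u).
have us (u : induced C) : index (val u) s < size s by rewrite index_mem Cs // (valP u).
exists (fun u => Ordinal (lt_n u)); split=> [u v|u v].
  by move=> /(congr1 val)/addnI uv; apply: val_inj; rewrite -uE uv uE.
have -> : u -- v = nth x0 s (index (val u) s) -- nth x0 s (index (val v) s) by rewrite !uE.
rewrite [LHS]/= /on_rel -val_eqE /= eqn_add2l.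
case: (ltngtP (index (val u) s) (index (val v) s)) => [lt_uv|lt_vu|->] /=.
- by rewrite sE ?us.
- by rewrite sedge_sym sE ?us // orbC.
- by rewrite sedge_irrefl.
Qed.

(** * Neighbourhoods of K4 and diamonds in a graph as in (4) *)

Section Structure.
Variable G : sgraph.
Hypothesis G_free : induced_free forbidden G.
Implicit Types a b c d v w x y : G.

Ltac edge := first [assumption | rewrite sedge_sym; assumption].
Ltac neq := first [assumption | rewrite eq_sym; assumption | apply: edge_neq; edge].
(** The list [s] gives the images of the vertices 0, 1, 2, ... of the forbidden graph [F], in that
    order. *)
Ltac forbid F x s := exfalso; apply: (G_free F); apply: (@list_induced _ _ _ x s);
  [by [] | rewrite /= !inE !negb_or; repeat (apply/andP; split); solve [by [] | neq]
  | do 2 (case=> [|[|[|[|[|?]]]]] //); move=> _ _ /=; edge].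

Lemma no_claw v a b c : v -- a -> v -- b -> v -- c -> a != b -> a != c -> b != c ->
  [|| a -- b, a -- c | b -- c].
Proof.
move=> va vb vc ne_ab ne_ac ne_bc.
case ab: (a -- b) => //; case ac: (a -- c) => //; case bc: (b -- c) => //.
by forbid Forb_claw v [:: v; a; b; c].
Qed.

(** If [v] is adjacent to [a], its 4, 3, 2 or 1 neighbours in the K4 give [K5], [K5e], [X2] or
    [K4l]. The other vertices of the K4 follow by permutation. *)
Lemma K4_closed a b c d v :
    [/\ a -- b, a -- c & a -- d] -> [/\ b -- c, b -- d & c -- d] ->
    v \notin [:: a; b; c; d] -> ~~ (v -- a).
Proof.
case=> ab ac ad [bc bd cd]; rewrite !inE !negb_or => /and4P[neq_va neq_vb neq_vc neq_vd].
apply/negP => va.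
case vb: (v -- b); case vc: (v -- c); case vd: (v -- d).
- by forbid Forb_K5 a [:: a; b; c; d; v].
- by forbid Forb_K5e a [:: d; a; b; c; v].
- by forbid Forb_K5e a [:: c; a; b; d; v].
- by forbid Forb_X2 a [:: c; a; b; v; d].
- by forbid Forb_K5e a [:: b; a; c; d; v].
- by forbid Forb_X2 a [:: b; a; c; v; d].
- by forbid Forb_X2 a [:: b; a; d; v; c].
- by forbid Forb_K4l a [:: a; b; c; d; v].
Qed.

(** Each of the fifteen nonempty sets of neighbours of [v] in the diamond gives a forbidden graph;
    it is a claw if [v] sees a vertex of degree 3 and neither vertex of degree 2. *)
Lemma diamond_closed a b c d v :
    [/\ a -- b, a -- c & b -- c] -> [/\ b -- d, c -- d & a -- d = false] -> a != d ->
    v \notin [:: a; b; c; d] -> [|| v -- a, v -- b, v -- c | v -- d] = false.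
Proof.
case=> ab ac bc [bd cd ad] neq_ad.
rewrite !inE !negb_or => /and4P[neq_va neq_vb neq_vc neq_vd].
case va: (v -- a); case vb: (v -- b); case vc: (v -- c); case vd: (v -- d) => //.
- by forbid Forb_K5e a [:: a; b; c; v; d].
- by forbid Forb_X2 a [:: v; b; c; d; a].
- by forbid Forb_wheel4 a [:: v; a; c; d; b].
- by forbid Forb_gem a [:: v; a; c; d; b].
- by forbid Forb_wheel4 a [:: v; a; b; d; c].
- by forbid Forb_gem a [:: v; a; b; d; c].
- by forbid Forb_X1 a [:: a; b; c; d; v].
- by forbid Forb_kite a [:: a; b; c; d; v].
- by forbid Forb_X2 a [:: v; b; c; a; d].
- by forbid Forb_claw a [:: b; a; d; v].
- by forbid Forb_gem a [:: v; d; c; a; b].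
- by forbid Forb_claw a [:: b; a; d; v].
- by forbid Forb_gem a [:: v; d; b; a; c].
- by forbid Forb_claw a [:: c; a; d; v].
- by forbid Forb_kite a [:: d; b; c; a; v].
Qed.

(** * Longest paths in a component without K4 or diamond *)

Section NoDiamond.
Variable C : {set G}.
Hypothesis C_closed : forall x y, x \in C -> x -- y -> y \in C.
(** Adjacency of [a] and [d] is left open, so K4 is excluded together with the diamond. *)
Hypothesis no_diamond : forall a b c d, b \in C ->
  a -- b -> a -- c -> b -- c -> b -- d -> c -- d -> a = d.

(* A triangle with further neighbours c and y at two of its vertices extends to *)
(* a house or a bull.                                                           *)
Lemma triangle_nbr v a b c y : v \in C ->
  v -- a -> v -- b -> v -- c -> a -- b -> c != a -> c != b -> a -- y -> y = v \/ y = b.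
Proof.
move=> vC va vb vc ab neq_ca neq_cb ay; have aC := C_closed vC va.
case: (eqVneq y v) => [|neq_yv]; first by left.
case: (eqVneq y b) => [|neq_yb]; first by right.
have neq_yc : y != c.
  apply: contra_neq neq_cb => yc; rewrite yc in ay.
  by apply: (@no_diamond c v a b); edge.
case ac: (a -- c).
  by case/eqP: neq_cb; apply: (@no_diamond c v a b); edge.
case bc: (b -- c).
  by case/eqP: neq_ca; apply: (@no_diamond c v b a); edge.
case vy: (v -- y).
  by case/eqP: neq_yb; apply: (@no_diamond y v a b); edge.
case by_: (b -- y).
  by case/eqP: neq_yv; apply: (@no_diamond y a b v); edge.
case cy: (c -- y).
  by forbid Forb_house v [:: v; a; y; c; b].
by forbid Forb_bull v [:: v; a; b; c; y].
Qed.

Definition trail (s : seq G) : Prop :=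
  [/\ uniq s, sorted (@sedge G) s & {subset s <= C}].

Definition longest (s : seq G) : Prop :=
  [/\ 0 < size s, trail s & forall t, trail t -> size t <= size s].

Lemma longest_rev s : longest s -> longest (rev s).
Proof.
case=> s_gt0 [s_uniq s_path sC] s_max; split; rewrite ?size_rev //.
split; rewrite ?rev_uniq //; last by move=> x; rewrite mem_rev; apply: sC.
by rewrite rev_sorted (eq_sorted (e' := @sedge G)) // => x y; apply: sedge_sym.
Qed.

Lemma exists_longest x : x \in C -> exists s, longest s.
Proof.
move=> xC; pose P n := [exists t : n.-tuple G,
  [&& uniq t, sorted (@sedge G) t & all (mem C) t]].
have P1 : exists n, P n.
  by exists 1; apply/existsP; exists [tuple x]; rewrite /= xC.
have Pmax n : P n -> n <= #|G|.
  case/existsP => t /andP[t_uniq _].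
  by rewrite -(size_tuple t) -(card_uniqP t_uniq) max_card.
case: (ex_maxnP P1 Pmax) => n /existsP[t /and3P[t_uniq t_path /allP tC]] n_max.
have t_max s : trail s -> size s <= size t.
  case=> s_uniq s_path sC; rewrite size_tuple n_max //; apply/existsP; exists (in_tuple s).
  by apply/and3P; split=> //; apply/allP.
exists t; split=> //; apply: (t_max [:: x]).
by split=> // y; rewrite inE => /eqP->.
Qed.

Section Longest.
Variables (s : seq G) (x0 : G).
Hypothesis s_long : longest s.
Let p i := nth x0 s i.

Lemma longest_inj i j : p i = p j -> i < size s -> j < size s -> i = j.
Proof.
case: s_long => _ [s_uniq _ _] _ /eqP pij lti ltj; move: pij.
by rewrite nth_uniq // => /eqP.
Qed.

Lemma longest_edge i : i.+1 < size s -> p i -- p i.+1.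
Proof. by case: s_long => _ [_ /(sortedP x0) s_path _] _; apply: s_path. Qed.

Lemma longest_mem i : i < size s -> p i \in C.
Proof. by case: s_long => _ [_ _ sC] _ lti; apply/sC/mem_nth. Qed.

Lemma longest_first y : y -- p 0 -> y \in s.
Proof.
case: s_long => s_gt0 [s_uniq s_path sC] s_max yp; apply/negPn/negP => ys.
have : trail (y :: s).
  split; first by rewrite /= ys.
    by move: yp; rewrite /p; case: (s) s_gt0 s_path => //= z t _ -> ->.
  move=> z; rewrite inE => /predU1P[->|/sC //].
  by apply: (@C_closed (p 0)); [apply: longest_mem | rewrite sedge_sym].
by move=> /s_max; rewrite /= ltnn.
Qed.

(** In the triangle [p i], [p i.+1], [w] the vertex [p i] has the outside neighbour [p i.-1], so the
    other two have none. The path must therefore run through [w] next and stop there. The last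
    hypothesis is what [longest_first] gives for the reversed path. *)
Lemma longest_ahead i w : 0 < i -> i.+1 < size s -> p i -- w -> w != p i.-1 ->
  w -- p i.+1 -> (forall y, y -- p (size s).-1 -> y \in s) -> 
  w = p i.+2 /\ i.+3 = size s.
Proof.
move=> i_gt0 lti iw neq_w ww s_last.
have ii : p i -- p i.+1 by apply: longest_edge.
have ip : p i.-1 -- p i by have := @longest_edge i.-1; rewrite prednK //; apply; lia.
have iC : p i \in C by apply: longest_mem; lia.
have neq_pp : p i.-1 != p i.+1.
  by apply/eqP => /longest_inj; lia.
have nbr_next y : p i.+1 -- y -> y = p i \/ y = w.
  by apply: (@triangle_nbr _ _ _ (p i.-1)); first [edge | neq].
have nbr_w y : w -- y -> y = p i \/ y = p i.+1.
  by apply: (@triangle_nbr _ _ _ (p i.-1)); first [edge | neq].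
have [last_i|lt2] : i.+2 = size s \/ i.+2 < size s by lia.
  have /(nthP x0)[j ltj jw] : w \in s by apply: s_last; rewrite -last_i.
  rewrite -/(p j) in jw; have {}ltj : j < i.+2 by rewrite last_i.
  have neq_j : j <> i /\ j <> i.+1.
    split=> eq_j; rewrite -eq_j jw sedge_irrefl // in iw ww *.
  have jj : p j -- p j.+1 by apply: longest_edge; lia.
  rewrite jw in jj; have neq_ji : j.+1 <> i.
    by move=> E; rewrite -E /= jw eqxx in neq_w.
  by case: (nbr_w _ jj) => /longest_inj E; exfalso; lia.
have wE : w = p i.+2.
  by case: (nbr_next _ (longest_edge lt2)) => // /longest_inj E; exfalso; lia.
split=> //; apply/eqP; rewrite eqn_leq lt2 leqNgt /=; apply/negP => lt3.
by have := longest_edge lt3; rewrite -wE => /nbr_w[] /longest_inj E; exfalso; lia.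
Qed.
End Longest.

Lemma longest_last s x0 y : longest s -> y -- nth x0 s (size s).-1 -> y \in s.
Proof.
move=> s_long; have [s_gt0 _ _] := s_long; rewrite -mem_rev => py.
apply: (longest_first (x0 := x0) (longest_rev s_long)).
by rewrite nth_rev // subn1.
Qed.

(** As there is no claw at [p i], two of [p i.-1], [p i.+1] and [w] are adjacent. If [w] is one of
    them, [longest_ahead] applies to the path or to its reverse; otherwise the path is a mere
    triangle and [w] prolongs it. *)
Lemma longest_nbr s x0 i w : longest s -> let p := nth x0 s in
    0 < i -> i.+1 < size s -> p i -- w -> w != p i.-1 -> w != p i.+1 ->
  w = p i.+2 /\ i.+3 = size s \/ w = p 0 /\ i = 2.
Proof.
move=> s_long p i_gt0 lti iw neq_wp neq_wn.
have ii : p i -- p i.+1 by apply: (longest_edge x0 s_long).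
have ip : p i.-1 -- p i.
  by have := @longest_edge _ x0 s_long i.-1; rewrite prednK //; apply; lia.
have iC : p i \in C by apply: (longest_mem x0 s_long); lia.
have neq_pn : p i.-1 != p i.+1.
  by apply/eqP => /(longest_inj s_long) E; clear -E lti i_gt0; lia.
have : [|| p i.-1 -- p i.+1, p i.-1 -- w | p i.+1 -- w].
  by apply: (@no_claw (p i)); first [edge | neq].
case/or3P => [pn|pw|nw].
- have nbr_prev y : p i.-1 -- y -> y = p i \/ y = p i.+1.
    by apply: (@triangle_nbr _ _ _ w); first [edge | neq].
  have nbr_next y : p i.+1 -- y -> y = p i \/ y = p i.-1.
    by apply: (@triangle_nbr _ _ _ w); first [edge | neq].
  have i1 : i = 1.
    apply/eqP; rewrite eqn_leq i_gt0 andbT leqNgt; apply/negP => i_gt1.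
    have : p i.-2 -- p i.-1.
      by have := @longest_edge _ x0 s_long i.-2; rewrite prednK; [apply|]; lia.
    rewrite sedge_sym => /nbr_prev[] /(longest_inj s_long) E; clear -E lti i_gt1; lia.
  have sz3 : size s = 3.
    apply/eqP; rewrite eqn_leq [2 < _](_ : _ = true) ?andbT; last by rewrite -i1.
    rewrite leqNgt; apply/negP => lt3; rewrite -[3]/(2.+1) -i1 in lt3.
    have := longest_edge x0 s_long lt3; rewrite -/p => /nbr_next[] /(longest_inj s_long) E.
      by clear -E lt3 lti i_gt0; lia.
    by clear -E lt3 lti i_gt0; lia.
  have [_ [_ _ sC] s_max] := s_long.
  (* Entering the triangle from [w] and going round it gives four vertices against three. *)
  have : trail [:: w; p i; p i.-1; p i.+1].
    split.
    - by rewrite /= !inE !negb_or; repeat (apply/andP; split); solve [by [] | neq].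
    - by rewrite /= ![_ -- p i]sedge_sym; apply/and4P; split=> //; edge.
    - move=> y; rewrite !inE => /or4P[] /eqP-> //.
      + exact: C_closed iC iw.
      + by apply: (C_closed iC); edge.
      + exact: C_closed iC ii.
  by move/s_max; rewrite sz3.
- right.
  (* [j] is the position of [p i] in the reversed path. *)
  have [j [sz_i j_gt0 ltj]] : exists j, [/\ size s = (i + j).+1, 0 < j & j.+1 < size s].
    by exists (size s - i.+1); clear -i_gt0 lti; split; lia.
  have pE l m : size s = (m + l).+1 -> nth x0 (rev s) l = p m.
    by move=> szE; rewrite nth_rev szE ?subSS ?addnK // ltnS leq_addl.
  have e0 := pE j i sz_i.
  have e1 : nth x0 (rev s) j.-1 = p i.+1.
    by apply: pE; clear -sz_i j_gt0; lia.
  have e2 : nth x0 (rev s) j.+1 = p i.-1.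
    by apply: pE; clear -sz_i i_gt0; lia.
  have [] := @longest_ahead (rev s) x0 (longest_rev s_long) j w;
    rewrite ?size_rev ?e0 ?e1 ?e2 //.
  + by edge.
  + move=> y; rewrite mem_rev (pE _ 0); first exact: longest_first.
    by case: (s_long) => s_gt0 _ _; rewrite add0n prednK.
  + move=> wE szE; have i2 : i = 2 by clear -sz_i szE; lia.
    by split=> //; rewrite wE (pE _ 0) // -szE.
- left; apply: (longest_ahead s_long) => //; first by edge.
  by move=> y; apply: longest_last.
Qed.

(** Consequently a longest path runs through its whole component. *)
Lemma longest_closed s x0 i y : longest s -> i < size s -> nth x0 s i -- y -> y \in s.
Proof.
move=> s_long lti iy.
have [i0|i_gt0] := posnP i.
  by apply: (longest_first (x0 := x0) s_long); rewrite -i0 sedge_sym.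
have [iz|ltSi] : i = (size s).-1 \/ i.+1 < size s by lia.
  by apply: (longest_last (x0 := x0) s_long); rewrite -iz sedge_sym.
have [->|neq_wp] := eqVneq y (nth x0 s i.-1).
  exact/mem_nth/(leq_ltn_trans (leq_pred i) lti).
have [->|neq_wn] := eqVneq y (nth x0 s i.+1); first exact/mem_nth.
case: (longest_nbr s_long i_gt0 ltSi iy neq_wp neq_wn) => [[-> E]|[-> _]].
  by apply: mem_nth; rewrite -E.
exact/mem_nth/(leq_ltn_trans _ lti).
Qed.

(** [longest_nbr] is applied at whichever end of the chord is interior to the path; if neither is,
    the chord joins the two ends. *)
Lemma longest_adj s x0 i j : longest s -> i < j -> j < size s ->
  nth x0 s i -- nth x0 s j ->
  [\/ j = i.+1, i = 0 /\ j = 2, j = i.+2 /\ j.+1 = size s | i = 0 /\ j.+1 = size s].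
Proof.
move=> s_long ltij ltj ij.
have [->|neq_j] := eqVneq j i.+1; first by apply: Or41.
have neqP l m : l < size s -> m < size s -> l != m -> nth x0 s l != nth x0 s m.
  by move=> ltl ltm; apply: contra_neq => /(longest_inj s_long); apply.
have [i0|i_gt0] := posnP i; last first.
  case: (@longest_nbr s x0 i (nth x0 s j) s_long i_gt0) => //; try (apply: neqP; lia).
  - lia.
  - by case=> /(longest_inj s_long) E szE; apply: Or43; lia.
  - by case=> /(longest_inj s_long) E szE; exfalso; lia.
have [szE|ltSj] : j.+1 = size s \/ j.+1 < size s by lia.
  by apply: Or44.
case: (@longest_nbr s x0 j (nth x0 s i) s_long) => //; try (apply: neqP; lia); try edge.
- lia.
- by case=> /(longest_inj s_long) E szE; exfalso; lia.
- by case=> /(longest_inj s_long) E szE; apply: Or42; lia.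
Qed.

Lemma cycle_adj n i j : i < j -> j < n ->
  (j == i.+1 %% n) || (i == j.+1 %% n) = (j == i.+1) || (i == 0) && (j.+1 == n).
Proof.
move=> ltij ltjn; rewrite [i.+1 %% n]modn_small; last exact: leq_ltn_trans ltjn.
have [<-|neq_j] := eqVneq j.+1 n; first by rewrite modnn andbT.
by rewrite modn_small; lia.
Qed.

(** The edge between the two ends excludes the end triangles, so the cycle is chordless, and it is
    even because odd holes are forbidden. *)
Lemma longest_cycle s x0 n : longest s -> {subset C <= s} -> size s = n -> 3 < n ->
    nth x0 s 0 -- nth x0 s n.-1 ->
  exists2 m, 2 <= m & induced_subgraph_of (induced C) (cycle_graph m.*2).
Proof.
move=> s_long Cs sz_s n_gt3; set p := nth x0 s => pp.
have pC i : i < n -> p i \in C by rewrite -sz_s; apply: longest_mem.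
have p_inj i j : p i = p j -> i < n -> j < n -> i = j by rewrite -sz_s; apply: longest_inj.
have p_edge i : i.+1 < n -> p i -- p i.+1 by rewrite -sz_s; apply: longest_edge.
have neqP i j : i < n -> j < n -> i != j -> p i != p j.
  by move=> lti ltj; apply: contra_neq => /p_inj; apply.
have p01 : p 0 -- p 1 by apply: p_edge; lia.
have p12 : p 1 -- p 2 by apply: p_edge; lia.
have p23 : p 2 -- p 3 by apply: p_edge; lia.
have no02 : p 0 -- p 2 = false.
  (* In the triangle on [p 0], [p 1], [p 2], both [p 0] and [p 2] would have outside neighbours:
     [p n.-1] and [p 3]. *)
  apply/negP => p02; have := @triangle_nbr (p 0) (p 2) (p 1) (p n.-1) (p 3).
  case; try (apply: neqP; clear -n_gt3; lia); try edge.
  - by apply: pC; lia.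
  - by move=> /p_inj E; clear -E n_gt3; lia.
  - by move=> /p_inj E; clear -E n_gt3; lia.
have [k nE] : exists k, n = k.+4 by exists (n - 4); lia.
have no13 : p k.+1 -- p k.+3 = false.
  rewrite nE /= in pp; have q01 : p k -- p k.+1 by apply: p_edge; clear -nE; lia.
  have q12 : p k.+1 -- p k.+2 by apply: p_edge; clear -nE; lia.
  have q23 : p k.+2 -- p k.+3 by apply: p_edge; clear -nE; lia.
  apply/negP => q13; have := @triangle_nbr (p k.+3) (p k.+1) (p k.+2) (p 0) (p k).
  case; try (apply: neqP; clear -nE; lia); try edge.
  - by apply: pC; lia.
  - by move=> /p_inj E; clear -E nE; lia.
  - by move=> /p_inj E; clear -E nE; lia.
have adjE i j : i < j -> j < n -> p i -- p j = (j == i.+1 %% n) || (i == j.+1 %% n).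
  move=> ltij ltj; rewrite cycle_adj //; apply/idP/idP.
    move=> ij; rewrite -sz_s in ltj.
    case: (longest_adj s_long ltij ltj ij) => [->|[i0 j2]|[j2 jn]|[-> jn]].
    - by rewrite eqxx.
    - by rewrite i0 j2 -/p no02 in ij.
    - have [ei ej] : i = k.+1 /\ j = k.+3 by rewrite sz_s in jn; clear -j2 jn nE; lia.
      by rewrite ei ej -/p no13 in ij.
    - by rewrite jn sz_s !eqxx orbT.
  case/orP => [/eqP jE|/andP[/eqP -> /eqP jE]].
    by rewrite jE; apply: p_edge; rewrite -jE.
  by have -> : j = n.-1 by rewrite -jE.
have [n_odd|n_even] := boolP (odd n).
  have [m nm] : exists m, n = m.*2.+1 by exists n./2; clear -n_odd; lia.
  have m_ge2 : 2 <= m by clear -nm n_gt3; lia.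
  case: (G_free (Forb_odd_hole m_ge2)); rewrite -nm.
  apply: (list_induced (x0 := x0) sz_s) => //.
  by case: s_long => _ [].
have [m nm] : exists m, n = m.*2 by exists n./2; clear -n_even; lia.
exists m; first by clear -nm n_gt3; lia.
rewrite -nm; apply: (@induced_list _ _ _ x0 s C 0) => //.
- by case: s_long => _ [].
- by rewrite add0n sz_s.
- by move=> i j; rewrite sz_s; apply: adjE.
Qed.

Lemma longest_tail s x0 n : longest s -> {subset C <= s} -> size s = n ->
    (3 < n -> nth x0 s 0 -- nth x0 s n.-1 = false) ->
    (3 < n -> nth x0 s (n - 3) -- nth x0 s n.-1 = false) ->
  exists l, induced_subgraph_of (induced C) (butterfly l.*2.+1).
Proof.
move=> s_long Cs sz_s; set p := nth x0 s => no_cycle no_tail.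
(* The butterfly is chosen so long that its second triangle is out of reach. Without the chord
   [p 0 -- p 2] the path starts at vertex 1. For [n < 3], [p 2] is only the default [x0], and either
   value of [d] will do. *)
exists n; pose d : nat := ~~ (p 0 -- p 2).
have s_uniq : uniq s by case: s_long => _ [].
have d_le1 : d <= 1 by rewrite /d; case: (_ -- _).
apply: (@induced_list _ _ _ x0 s C d) => //; first by rewrite sz_s; clear -d_le1; lia.
rewrite sz_s -/p => i j ltij ltj.
have -> : p i -- p j = (j == i.+1) || [&& d == 0, i == 0 & j == 2].
  apply/idP/idP => [ij|]; last first.
    case/orP => [/eqP jE|/and3P[d0 /eqP-> /eqP->]].
      by rewrite jE; apply: (longest_edge x0 s_long); rewrite -jE sz_s.
    by move: d0; rewrite /d; case: (p 0 -- p 2).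
  have short : i = 0 -> j = 2 -> (j == i.+1) || [&& d == 0, i == 0 & j == 2].
    by move=> i0 j2; move: ij; rewrite i0 j2 /d => ->.
  have ltj_s := ltj; rewrite -sz_s in ltj_s.
  case: (longest_adj s_long ltij ltj_s ij) => [->|[i0 j2]|[j2]|[i0]]; rewrite ?sz_s.
  - by rewrite eqxx.
  - exact: short.
  - move=> jn; case: (ltnP 3 n) => [n_gt3|n_le3]; last first.
      by apply: short; clear -j2 jn n_le3; lia.
    have [ei ej] : i = n - 3 /\ j = n.-1 by clear -j2 jn n_gt3; lia.
    by move: ij; rewrite ei ej no_tail.
  - move=> jn; case: (ltnP 3 n) => [n_gt3|n_le3].
      have ej : j = n.-1 by clear -jn; lia.
      by move: ij; rewrite i0 ej no_cycle.
    have [j1|j2] : j = 1 \/ j = 2 by clear -i0 ltij jn n_le3; lia.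
      by rewrite i0 j1.
    exact: short.
clear -d_le1 ltij ltj; lia.
Qed.

Lemma longest_structure s (x0 : G) : longest s -> {subset C <= s} ->
  (exists2 m, 2 <= m & induced_subgraph_of (induced C) (cycle_graph m.*2)) \/
  exists n, induced_subgraph_of (induced C) (butterfly n.*2.+1).
Proof.
move=> s_long Cs; have [n sz_s] : exists n, size s = n by exists (size s).
pose p := nth x0 s.
have [/andP[n_gt3 cyc]|no_cyc] := boolP ((3 < n) && (p 0 -- p n.-1)).
  by left; apply: longest_cycle sz_s _ cyc.
have no_cycle : 3 < n -> p 0 -- p n.-1 = false.
  by move=> n_gt3; move: no_cyc; rewrite n_gt3 => /negPf.
right; case tail: ((3 < n) && (p (n - 3) -- p n.-1)); last first.
  by apply: (longest_tail s_long Cs sz_s no_cycle) => n_gt3; move: tail; rewrite n_gt3.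
case/andP: tail => n_gt3 tail.
(* With a triangle only at the far end, the reversed path has it in front and [longest_tail]
   applies. *)
case head: (p 0 -- p 2); last first.
  have pE l m : l + m = n.-1 -> nth x0 (rev s) l = p m.
    move=> lm; rewrite nth_rev sz_s; last by clear -lm n_gt3; lia.
    by congr (nth x0 s); clear -lm n_gt3; lia.
  apply: (@longest_tail (rev s) x0 n (longest_rev s_long)) => [y /Cs|||].
  - by rewrite mem_rev.
  - by rewrite size_rev.
  - rewrite (pE 0 n.-1) // (pE n.-1 0) ?addn0 // sedge_sym; exact: no_cycle.
  - rewrite (pE n.-1 0) ?addn0 // (pE (n - 3) 2); last by clear -n_gt3; lia.
    by rewrite sedge_sym.
have p_edge i : i.+1 < n -> p i -- p i.+1 by rewrite -sz_s; apply: longest_edge.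
(* With four vertices the two end triangles would share the edge between [p 1] and [p 2]. *)
have n_gt4 : 4 < n.
  rewrite ltn_neqAle n_gt3 andbT; apply/eqP => n4; rewrite -n4 in tail p_edge.
  have : p 0 = p 3.
    have p1C : p 1 \in C by apply: (longest_mem x0 s_long); rewrite sz_s -n4.
    by apply: (no_diamond p1C (p_edge 0 isT) head (p_edge 1 isT) tail (p_edge 2 isT)).
  by move=> /(longest_inj s_long); rewrite sz_s -n4 => /(_ isT isT).
(* Both end triangles are present, so the path is a [k]-butterfly, and [k] is odd because even
   butterflies are forbidden. *)
have [k nE] : exists k, n = k + 5 by exists (n - 5); clear -n_gt4; lia.
have [e3 e1] : n - 3 = k.+2 /\ n.-1 = k.+4 by clear -nE; lia.
rewrite e3 e1 in tail no_cycle.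
have adjE i j : i < j -> j < n -> p i -- p j =
    [|| j == i.+1, (i == 0) && (j == 2) | (i == k + 2) && (j == k + 4)]
    || [|| i == j.+1, (j == 0) && (i == 2) | (j == k + 2) && (i == k + 4)].
  move=> ltij ltj.
  have -> : [|| i == j.+1, (j == 0) && (i == 2) | (j == k + 2) && (i == k + 4)] = false.
    by clear -ltij; lia.
  rewrite orbF; apply/idP/idP => [ij|].
    have ltj_s := ltj; rewrite -sz_s in ltj_s.
    case: (longest_adj s_long ltij ltj_s ij) => [->|[-> ->]|[j2]|[i0]];
      rewrite ?eqxx ?orbT // sz_s => jn.
      by clear -j2 jn nE; lia.
    by have ej : j = k.+4 by [clear -jn nE; lia]; move: ij; rewrite i0 ej no_cycle.
  case/or3P => [/eqP jE|/andP[/eqP-> /eqP->] //|/andP[/eqP-> /eqP->]].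
    by rewrite jE; apply: p_edge; rewrite -jE.
  by rewrite !addnS addn0.
have s_uniq : uniq s by case: s_long => _ [].
have [k_odd|k_even] := boolP (odd k).
  have [l kl] : exists l, k = l.*2.+1 by exists k./2; clear -k_odd; lia.
  exists l; rewrite -kl; apply: (@induced_list _ _ _ x0 s C 0) => //.
    by rewrite sz_s nE.
  by move=> i j; rewrite sz_s; apply: adjE.
have [l kl] : exists l, k = l.*2 by exists k./2; clear -k_even; lia.
case: (G_free (Forb_even_butterfly l)); rewrite -kl.
by apply: (list_induced (x0 := x0) (s := s)); rewrite -?nE.
Qed.
End NoDiamond.

(** * Classification of the components and the equivalence *)

Lemma component_sub (x y : G) (s : seq G) : y \in component x -> y \in s ->
  (forall u v, u \in s -> u -- v -> v \in s) -> {subset component x <= s}.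
Proof.
rewrite mem_component connect_edge_sym => yx ys s_closed z; rewrite mem_component => xz.
have closed_s : closed (@sedge G) (mem s).
  apply: intro_closed => [|u v uv us]; first exact: connect_edge_sym.
  exact: s_closed uv.
by rewrite -(closed_connect closed_s (connect_trans yx xz)).
Qed.

Lemma free_component (C : {set G}) : C \in components G ->
  [\/ induced_subgraph_of (induced C) (complete_graph 4),
      induced_subgraph_of (induced C) diamond,
      exists2 m : nat, 2 <= m & induced_subgraph_of (induced C) (cycle_graph m.*2)
    | exists n : nat, induced_subgraph_of (induced C) (butterfly n.*2.+1)].
Proof.
case/componentsP=> x ->{C}.
(* [P] describes two triangles on a common edge; whether [a -- d] holds then separates K4 from the
   diamond. *)
pose P (q : G * G * G * G) := let: (a, b, c, d) := q in
  [&& b \in component x, a -- b, a -- c, b -- c, b -- d, c -- d & a != d].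
have [/existsP[[[[a b] c] d]] | /existsPn noP] := boolP [exists q, P q].
  case/and5P=> bC ab ac bc /and3P[bd cd neq_ad].
  have s_uniq : uniq [:: a; b; c; d].
    by rewrite /= !inE !negb_or; repeat (apply/andP; split); solve [by [] | neq].
  case ad: (a -- d).
    apply: Or41; apply: (@induced_list _ _ _ a [:: a; b; c; d] _ 0) => //.
      apply: (component_sub bC); first by rewrite !inE eqxx orbT.
      move=> u v us uv; apply/negPn/negP => vs.
      have {uv} vu : v -- u by rewrite sedge_sym.
      move: vs; rewrite !inE !negb_or => /and4P[neq_va neq_vb neq_vc neq_vd].
      move: us vu; rewrite !inE => /or4P[] /eqP->; apply/negP.
      - by apply: (K4_closed (b := b) (c := c) (d := d));
          [split; edge | split; edge | rewrite !inE !negb_or; apply/and4P].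
      - by apply: (K4_closed (b := a) (c := c) (d := d));
          [split; edge | split; edge | rewrite !inE !negb_or; apply/and4P].
      - by apply: (K4_closed (b := a) (c := b) (d := d));
          [split; edge | split; edge | rewrite !inE !negb_or; apply/and4P].
      - by apply: (K4_closed (b := a) (c := b) (d := c));
          [split; edge | split; edge | rewrite !inE !negb_or; apply/and4P].
    by do 2 (case=> [|[|[|[|?]]]] //).
  apply: Or42; apply: (@induced_list _ _ _ a [:: a; b; c; d] _ 0) => //.
    apply: (component_sub bC); first by rewrite !inE eqxx orbT.
    move=> u v us uv; apply/negPn/negP => vs.
    have E : [|| v -- a, v -- b, v -- c | v -- d] = false.
      by apply: diamond_closed => //; split.
    by move: us uv; rewrite sedge_sym !inE => /or4P[] /eqP-> uv; rewrite uv ?orbT in E.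
  by do 2 (case=> [|[|[|[|?]]]] //).
have C_closed u v : u \in component x -> u -- v -> v \in component x.
  by rewrite !mem_component => xu uv; apply: connect_trans xu (connect1 uv).
have no_diamond a b c d : b \in component x ->
    a -- b -> a -- c -> b -- c -> b -- d -> c -- d -> a = d.
  move=> bC ab ac bc bd cd; apply/eqP; have := noP (a, b, c, d).
  by rewrite /P bC ab ac bc bd cd /= negbK.
have xC : x \in component x by rewrite mem_component.
have [s s_long] := exists_longest xC.
have [s_gt0 _ _] := s_long.
have Cs : {subset component x <= s}.
  apply: (component_sub (longest_mem x s_long s_gt0)); first exact: mem_nth.
  move=> u v /(nthP x)[i lti <-]; exact: (longest_closed C_closed no_diamond s_long).
case: (longest_structure C_closed no_diamond x s_long Cs); [exact: Or43 | exact: Or44].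
Qed.
End Structure.

Lemma matchable_component (G : sgraph) (C : {set G}) :
  [\/ induced_subgraph_of (induced C) (complete_graph 4),
      induced_subgraph_of (induced C) diamond,
      exists2 m : nat, 2 <= m & induced_subgraph_of (induced C) (cycle_graph m.*2)
    | exists n : nat, induced_subgraph_of (induced C) (butterfly n.*2.+1)] ->
  matchable (induced C).
Proof.
case=> [/induced_subgraphP[f]|/induced_subgraphP[f]|[m m_ge2]|[n]].
- by move/matchable_embedding; apply; apply: matchable_K4.
- by move/matchable_embedding; apply; apply: matchable_diamond.
- case/induced_subgraphP=> f /matchable_embedding; apply.
  exact: matchable_even_cycle.
- case/induced_subgraphP=> f /matchable_embedding; apply.
  exact: matchable_odd_butterfly.
Qed.

Theorem proposition25 (G : sgraph) :
  [<-> admits_free_colouring (pattern_set [:: bP3; rP3; bK3; rK3; rbbK3]) G;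
       admits_free_colouring (pattern_set [:: bP3; rP3; bK3; rK3; rrbK3]) G;
       forall C : {set G}, C \in components G ->
         [\/ induced_subgraph_of (induced C) (complete_graph 4),
             induced_subgraph_of (induced C) diamond,
             exists2 m : nat, 2 <= m &
               induced_subgraph_of (induced C) (cycle_graph m.*2)
           | exists n : nat,
               induced_subgraph_of (induced C) (butterfly n.*2.+1)];
       induced_free forbidden G].
Proof.
have blueP := @free_colouringP Blue G [:: bP3; rP3; bK3; rK3; rbbK3] (fun H => iff_refl _).
have redP :
    admits_free_colouring (pattern_set [:: bP3; rP3; bK3; rK3; rrbK3]) G <-> matchable G.
  by apply: (@free_colouringP Red) => H; rewrite /pattern_set /=; tauto.
(* (1) and (2) are both traded for [matchable G], and (3) follows from (2) by way of (4). *)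
tfae=> [/blueP/redP //|/redP/matchable_free/free_component //|GC|].
  by apply/matchable_free/matchable_components => C /GC/matchable_component.
move/free_component => GC; apply/blueP.
by apply: matchable_components => C /GC/matchable_component.
Qed.
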